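(* Let $G=(A,B,E)$ be a balanced bipartite graph with $2n$ vertices ($n\geq 1$) and let $X$ be its reduced adjacency matrix. Then $G$ is $\alpha^+$-stable if and only if there exist permutation matrices $P,Q$ of order $n$ and an integer $k\geq 1$ such that $$PXQ=\begin{bmatrix} X_1 & X_{12} & X_{13} & \cdots & X_{1k}\\ O & X_2 & X_{23} & \cdots & X_{2k}\\ \vdots & & \ddots & & \vdots\\ O & O & \cdots & O & X_k\end{bmatrix},$$ where $X_1,\dots,X_k$ are square fully indecomposable matrices, the blocks $O$ below the diagonal are zero matrices, and the blocks $X_{ij}$ ($i<j$) are arbitrary $(0,1)$-matrices.
   Context: All graphs are finite and simple. For a graph $G$, $\alpha(G)$ is the largest cardinality of a stable set. $G$ is $\alpha^+$-stable if $\alpha(G+e)=\alpha(G)$ for every pair $e=xy$ of distinct nonadjacent vertices $x,y$. A bipartite graph $G=(A,B,E)$ is balanced if $|A|=|B|$. With $A=\{a_1,\dots,a_n\}$, $B=\{b_1,\dots,b_n\}$, the reduced adjacency matrix is $X=[x_{ij}]$ with $x_{ij}=1$ iff $a_ib_j\in E$, else $0$. A square $(0,1)$-matrix of order $r$ is partly decomposable if either $r=1$ and its entry is $0$, or $r>1$ and it has a $k\times(r-k)$ zero submatrix for some $1\leq k\leq r-1$; otherwise it is fully indecomposable. *)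

(* Defs.v *)
From HB Require Import structures.
From mathcomp Require Import all_boot all_order all_algebra all_fingroup.

Set Implicit Arguments.
Unset Strict Implicit.
Unset Printing Implicit Defensive.

Import GRing.Theory.
Local Open Scope ring_scope.

Record sgraph (T : finType) := SGraph {
  adj :> rel T;
  adj_sym : symmetric adj;
  adj_irr : irreflexive adj
}.

Definition add_edge_rel (T : finType) (e : rel T) (x y : T) : rel T :=
  fun u v => [|| e u v, (u == x) && (v == y) | (u == y) && (v == x)].

Lemma add_edge_sym (T : finType) (G : sgraph T) (x y : T) :
  symmetric (add_edge_rel G x y).
Proof.
move=> u v; rewrite /add_edge_rel adj_sym; congr (_ || _).
by rewrite orbC andbC [X in _ || X]andbC.
Qed.

Lemma add_edge_irr (T : finType) (G : sgraph T) (x y : T) (xy : x != y) :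
  irreflexive (add_edge_rel G x y).
Proof.
move=> u; rewrite /add_edge_rel adj_irr /= andbC orbb.
by apply/negbTE; apply: contra xy => /andP[/eqP <- /eqP <-].
Qed.

Definition add_edge (T : finType) (G : sgraph T) (x y : T) (xy : x != y) :
  sgraph T := SGraph (add_edge_sym G x y) (add_edge_irr G xy).

Definition stable (T : finType) (G : sgraph T) (S : {set T}) : bool :=
  [forall x in S, forall y in S, ~~ G x y].

Definition alpha (T : finType) (G : sgraph T) : nat :=
  \max_(S : {set T} | stable G S) #|S|.

Definition alpha_plus_stable (T : finType) (G : sgraph T) : Prop :=
  forall (x y : T) (xy : x != y),
    ~~ G x y -> alpha (add_edge G xy) = alpha G.

Definition bipartition (T : finType) (G : sgraph T) (A B : {set T}) : Prop :=
  [/\ A :|: B = [set: T], [disjoint A & B], stable G A & stable G B].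

Definition enumerates (T : finType) (n : nat) (a : 'I_n -> T) (A : {set T}) :
  Prop := injective a /\ [set a i | i : 'I_n] = A.

Definition reduced_adj (T : finType) (G : sgraph T) (n : nat)
    (a b : 'I_n -> T) : 'M[int]_n :=
  \matrix_(i, j) (if G (a i) (b j) then 1 else 0).

Definition zero_one_mx (m n : nat) (M : 'M[int]_(m, n)) : Prop :=
  forall i j, M i j = 0 \/ M i j = 1.

(* A submatrix is selected by a set I of rows and a set J of columns. *)
Definition has_zero_submx (r k l : nat) (M : 'M[int]_r) : Prop :=
  exists I J : {set 'I_r},
    [/\ #|I| = k, #|J| = l & forall i j, i \in I -> j \in J -> M i j = 0].

Definition partly_decomposable (r : nat) (M : 'M[int]_r) : Prop :=
  (r = 1%N /\ forall i j, M i j = 0) \/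
  ((1 < r)%N /\
   exists k : nat, (1 <= k <= r - 1)%N /\ has_zero_submx k (r - k) M).

(* Matrices have order at least 1: the empty 'M_0 must be excluded by hand,
   since it is not partly decomposable. *)
Definition fully_indecomposable (r : nat) (M : 'M[int]_r) : Prop :=
  [/\ (0 < r)%N, zero_one_mx M & ~ partly_decomposable M].

(* Main.v *)
(** In a balanced bipartite graph, the exchange (intersection on A, union on B)
    makes the maximum stable sets a lattice; so when alpha G > n some vertex of
    A and, symmetrically, some vertex of B lie in all of them, and joining the
    two lowers alpha.  If alpha G = n, both sides are maximum stable sets, and
    one of them survives any added edge.  Hence alpha^+-stability means
    alpha G <= n, i.e. every p x q zero submatrix of X has p + q <= n.
    Indecomposable diagonal blocks force this bound.  Conversely, under the
    bound, a nonempty zero submatrix with p + q = n cuts X into two diagonal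
    blocks satisfying it again, and one recurses until the blocks are fully
    indecomposable. *)

Require Import Defs.
From HB Require Import structures.
From mathcomp Require Import all_boot all_order all_algebra all_fingroup zify.

Set Implicit Arguments.
Unset Strict Implicit.
Unset Printing Implicit Defensive.

Import GRing.Theory.
Local Open Scope ring_scope.

(** * Stable sets of bipartite graphs *)

Section StableSets.

Variables (T : finType) (G : sgraph T).
Implicit Types (A B S : {set T}) (x y : T).
Local Open Scope nat_scope.

Lemma stableP S :
  reflect (forall x y, x \in S -> y \in S -> ~~ G x y) (stable G S).
Proof.
apply: (iffP 'forall_in_'forall_in_idP) => [st x y xS yS | st x xS y yS].
  exact: (st x xS y yS).
exact: st.
Qed.

Lemma leq_alpha S : stable G S -> #|S| <= alpha G.
Proof. exact: (@leq_bigmax_cond _ (fun S => stable G S) (fun S => #|S|)). Qed.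

Lemma alpha_witness : exists2 S, stable G S & #|S| = alpha G.
Proof.
have st0 : stable G set0 by apply/stableP => x y; rewrite inE.
have [|S stS maxS] := @eq_bigmax_cond _ (fun S => stable G S) (fun S => #|S|).
  by apply/card_gt0P; exists set0.
by exists S.
Qed.

Lemma bipartition_sym A B : bipartition G A B -> bipartition G B A.
Proof. by case=> AB dAB stA stB; split; rewrite // 1?setUC 1?disjoint_sym. Qed.

Lemma bipartition_notin A B x : bipartition G A B -> (x \in B) = (x \notin A).
Proof.
case=> /setP/(_ x) + dAB _ _; rewrite !inE.
have [xA _|//] := boolP (x \in A).
by apply/negbTE; rewrite (disjointFr dAB xA).
Qed.

Definition exchange A S1 S2 := A :&: (S1 :&: S2) :|: (S1 :|: S2) :\: A.

(** An edge inside the exchange would join [A] to [B]. Its end in [A] lies in both [S1] and [S2] and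
    its end in [B] in one of them, so that one would contain the edge. *)
Lemma stable_exchange A B S1 S2 : bipartition G A B ->
  stable G S1 -> stable G S2 -> stable G (exchange A S1 S2).
Proof.
move=> bip /stableP st1 /stableP st2.
have inB x := bipartition_notin x bip.
have [_ _ /stableP stA /stableP stB] := bip.
apply/stableP => x y; rewrite !inE.
have [xA|xA] := boolP (x \in A); have [yA|yA] := boolP (y \in A) => /=;
  rewrite ?orbF.
- by move=> _ _; apply: stA.
- by case/andP=> x1 x2 /orP[]; [apply: st1 | apply: st2].
- by move=> /orP[x1|x2] /andP[y1 y2]; [apply: st1 | apply: st2].
- by move=> _ _; apply: stB; rewrite inB.
Qed.

(** On each side, one exchange keeps the intersection and the other the union. *)
Lemma card_exchange A B S1 S2 : bipartition G A B ->
  #|exchange A S1 S2| + #|exchange B S1 S2| = #|S1| + #|S2|.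
Proof.
move=> bip; have inB x := bipartition_notin x bip.
rewrite -cardsUI.
have -> : exchange A S1 S2 :|: exchange B S1 S2 = S1 :|: S2.
  by apply/setP=> x; rewrite !inE !inB; do ![case: (_ \in _)].
have -> : exchange A S1 S2 :&: exchange B S1 S2 = S1 :&: S2.
  by apply/setP=> x; rewrite !inE !inB; do ![case: (_ \in _)].
exact: cardsUI.
Qed.

(* By exchange, the maximum stable set with the smallest trace on A has its
   trace contained in every maximum stable set. *)
Lemma core_meets_side A B : bipartition G A B -> #|B| < alpha G ->
  exists2 x, x \in A &
    forall S, stable G S -> #|S| = alpha G -> x \in S.
Proof.
move=> bip ltB; have inB x := bipartition_notin x bip.
pose maxst S := stable G S && (#|S| == alpha G).
have [S0 stS0 cS0] := alpha_witness.
have mS0 : maxst S0 by rewrite /maxst stS0 cS0 eqxx.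
case: (arg_minnP (fun S => #|S :&: A|) mS0) => S /andP[stS /eqP cS] minS.
have [x] : exists x, x \in S :&: A.
  apply/set0Pn; apply: contraTneq ltB => SA0; rewrite -leqNgt -cS.
  apply/subset_leq_card/subsetP => x xS; rewrite inB; apply/negP => xA.
  by have := in_set0 x; rewrite -SA0 inE xS xA.
rewrite inE => /andP[xS xA]; exists x => // S' stS' cS'.
(* Neither exchange exceeds [alpha G] and together they have [2 * alpha G] elements, so both are
   maximum. *)
have cE := card_exchange S S' bip.
have leA := leq_alpha (stable_exchange bip stS stS').
have leB := leq_alpha (stable_exchange (bipartition_sym bip) stS stS').
have /minS leS : maxst (exchange A S S').
  by rewrite /maxst (stable_exchange bip) //=; apply/eqP; lia.
have sub : exchange A S S' :&: A \subset S :&: A.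
  by apply/subsetP => z; rewrite !inE; do ![case: (_ \in _)].
have /setP/(_ x) : exchange A S S' :&: A = S :&: A.
  by apply/eqP; rewrite eqEcard sub.
by rewrite !inE xS xA /= orbF andbT.
Qed.

Lemma sub_stable_add_edge S x y (xy : x != y) :
  stable (add_edge G xy) S -> stable G S.
Proof.
move=> /'forall_in_'forall_in_idP st; apply/stableP => u v uS vS.
by move: (st u uS v vS); rewrite /= negb_or => /andP[].
Qed.

End StableSets.

Lemma alpha_plus_stable_balanced (T : finType) (G : sgraph T) (A B : {set T}) :
  bipartition G A B -> #|A| = #|B| ->
  alpha_plus_stable G <-> (alpha G <= #|A|)%N.
Proof.
move=> bip cAB; have inB x := bipartition_notin x bip.
split=> [aps | leA x y xy nxy].
  rewrite leqNgt; apply/negP => ltA.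
  have [x xA corex] : exists2 x, x \in A &
      forall S, stable G S -> #|S| = alpha G -> x \in S.
    by apply: (core_meets_side bip); rewrite -cAB.
  have [y yB corey] := core_meets_side (bipartition_sym bip) ltA.
  have xy : x != y by apply: contraTneq yB => <-; rewrite inB xA.
  have [S stS cS] := alpha_witness G.
  have nxy := stableP _ _ stS _ _ (corex S stS cS) (corey S stS cS).
  (* With [alpha] unchanged, a maximum stable set of the enlarged graph is one of [G], hence
     contains both ends of the new edge. *)
  have [S' stS' cS'] := alpha_witness (add_edge G xy).
  have stGS' := sub_stable_add_edge stS'.
  rewrite (aps _ _ xy nxy) in cS'.
  have := stableP _ _ stS' _ _ (corex S' stGS' cS') (corey S' stGS' cS').
  by rewrite /= /add_edge_rel !eqxx orbT.
have stable_side C : stable G C -> ~~ ((x \in C) && (y \in C)) ->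
    stable (add_edge G xy) C.
  move=> /stableP stC nC; apply/stableP => u v uC vC.
  rewrite /= /add_edge_rel (negbTE (stC u v uC vC)) /=.
  apply: contra nC => /orP[] /andP[/eqP <- /eqP <-]; by rewrite uC vC.
apply/eqP; rewrite eqn_leq; apply/andP; split.
  have [S stS <-] := alpha_witness (add_edge G xy).
  exact/leq_alpha/(sub_stable_add_edge stS).
apply: (leq_trans leA); have [_ _ stA stB] := bip.
(* If both ends lie in [A], then [B] survives the new edge; otherwise [A] does. *)
have [/andP[xA yA]|nAxy] := boolP ((x \in A) && (y \in A)).
  by rewrite cAB; apply/leq_alpha/stable_side => //; rewrite !inB xA.
exact/leq_alpha/stable_side.
Qed.

(** * Splitting along zero blocks *)

Section BlockDecomposition.

Variables (U V : finType) (e : U -> V -> bool).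
Implicit Types (R I : {set U}) (C J : {set V}).
Local Open Scope nat_scope.

Definition anticomplete I J := [forall i in I, forall j in J, ~~ e i j].

Lemma anticompleteP I J :
  reflect (forall i j, i \in I -> j \in J -> ~~ e i j) (anticomplete I J).
Proof.
apply: (iffP 'forall_in_'forall_in_idP) => [ac i j iI jJ | ac i iI j jJ].
  exact: (ac i iI j jJ).
exact: ac.
Qed.

(** Full indecomposability of the submatrix on rows [R] and columns [C]; index sets let the
    recursion stay within fixed types. *)
Definition indecomposable R C :=
  [/\ #|R| = #|C|, 0 < #|R| &
      forall I J, I \subset R -> J \subset C -> I != set0 -> J != set0 ->
        anticomplete I J -> #|I| + #|J| < #|R|].

(** When [#|R| = #|C|] this is Hall's condition: for given [I] the largest [J] consists of the
    columns in [C] not adjacent to [I]. *)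
Definition small_zero_blocks R C :=
  forall I J, I \subset R -> J \subset C -> anticomplete I J ->
    #|I| + #|J| <= #|R|.

(** A zero block [I'] x [J'] of the part glues with [I] x [J] to the zero block [(I :|: I')] x [J']
    of the whole, whose bound yields the claim after subtracting [#|I|]. *)
Lemma small_zero_blocks_upper R C I J : I \subset R -> J \subset C ->
  anticomplete I J -> #|I| + #|J| = #|R| ->
  small_zero_blocks R C -> small_zero_blocks (R :\: I) J.
Proof.
move=> sI sJ /anticompleteP acIJ cIJ hall I' J' sI' sJ' /anticompleteP ac'.
have /subsetDP[sI'R dI'] := sI'.
have := hall (I :|: I') J'; rewrite subUset sI sI'R (subset_trans sJ' sJ).
have : #|I :|: I'| + #|I :&: I'| = #|I| + #|I'| by apply: cardsUI.
rewrite (disjoint_setI0 (A := I) (B := I')) 1?disjoint_sym // cards0.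
have : #|R :\: I| + #|I| = #|R| by rewrite -(cardsID I R) addnC (setIidPr sI).
move=> cD cU /(_ isT isT) le; suff /le : anticomplete (I :|: I') J' by lia.
apply/anticompleteP => i j; rewrite inE => /orP[iI|iI'] jJ'.
  by apply: acIJ => //; apply: (subsetP sJ').
exact: ac'.
Qed.

(** The same gluing on columns, with [I'] x [(J :|: J')]. *)
Lemma small_zero_blocks_lower R C I J : #|R| = #|C| -> I \subset R ->
  J \subset C -> anticomplete I J -> #|I| + #|J| = #|R| ->
  small_zero_blocks R C -> small_zero_blocks I (C :\: J).
Proof.
move=> cRC sI sJ /anticompleteP acIJ cIJ hall I' J' sI' sJ' /anticompleteP ac'.
have /subsetDP[sJ'C dJ'] := sJ'.
have := hall I' (J :|: J'); rewrite subUset sJ sJ'C (subset_trans sI' sI).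
have : #|J :|: J'| + #|J :&: J'| = #|J| + #|J'| by apply: cardsUI.
rewrite (disjoint_setI0 (A := J) (B := J')) 1?disjoint_sym // cards0.
move=> cU /(_ isT isT) le; suff /le : anticomplete I' (J :|: J') by lia.
apply/anticompleteP => i j iI'; rewrite inE => /orP[jJ|jJ'].
  by apply: acIJ => //; apply: (subsetP sI').
exact: ac'.
Qed.

(* A zero block I x J with |I| + |J| = |R| splits R x C into the
   diagonal blocks (R \ I) x J and I x (C \ J), the block I x J being zero. *)
Lemma indecomposable_blocks R C :
  #|R| = #|C| -> 0 < #|R| -> small_zero_blocks R C ->
  exists k (p : U -> nat) (q : V -> nat),
    [/\ 0 < k, {in R, forall i, p i < k}, {in C, forall j, q j < k},
        forall t, t < k ->
          indecomposable [set i in R | p i == t] [set j in C | q j == t] &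
        {in R & C, forall i j, q j < p i -> ~~ e i j}].
Proof.
have [m] := ubnP #|R|; elim: m => // m IHm in R C *.
move=> ltRm cRC R0 hall.
have [/existsP[I /existsP[J]]|indec] :=
  boolP [exists I : {set U}, exists J : {set V},
    [&& I \subset R, J \subset C, anticomplete I J, I != set0, J != set0 &
        #|R| <= #|I| + #|J|]]; last first.
  exists 1, (fun=> 0), (fun=> 0); split=> //= t; rewrite ltnS leqn0 => /eqP->.
  have -> : [set i in R | 0 == 0] = R by apply/setP=> i; rewrite !inE andbT.
  have -> : [set j in C | 0 == 0] = C by apply/setP=> j; rewrite !inE andbT.
  split=> // I J sI sJ I0 J0 ac; rewrite ltnNge.
  apply: contra indec => le; apply/existsP; exists I; apply/existsP; exists J.
  by rewrite sI sJ ac I0 J0 le.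
case/and5P=> sI sJ acIJ I0 /andP[J0 leR].
have {leR} cIJ : #|I| + #|J| = #|R|.
  by apply/eqP; rewrite eqn_leq leR andbT hall.
rewrite -card_gt0 in I0; rewrite -card_gt0 in J0.
have cRI : #|R :\: I| + #|I| = #|R|.
  by rewrite -(cardsID I R) addnC (setIidPr sI).
have cCJ : #|C :\: J| + #|J| = #|C|.
  by rewrite -(cardsID J C) addnC (setIidPr sJ).
have hallU := small_zero_blocks_upper sI sJ acIJ cIJ hall.
have hallL := small_zero_blocks_lower cRC sI sJ acIJ cIJ hall.
have [||||k1 [p1 [q1 [k1gt0 ltp1 ltq1 ind1 tri1]]]] := IHm (R :\: I) J; try lia.
  exact: hallU.
have [||||k2 [p2 [q2 [k2gt0 ltp2 ltq2 ind2 tri2]]]] := IHm I (C :\: J); try lia.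
  exact: hallL.
(* The labels of the second part are shifted by [k1], which places the zero block [I] x [J] below
   the diagonal. *)
exists (k1 + k2), (fun i => if i \in I then k1 + p2 i else p1 i),
  (fun j => if j \in J then q1 j else k1 + q2 j); split; first by lia.
- move=> i iR /=; have [iI|iI] := boolP (i \in I).
    by rewrite ltn_add2l ltp2.
  by rewrite ltn_addr // ltp1 // inE iI.
- move=> j jC /=; have [jJ|jJ] := boolP (j \in J).
    by rewrite ltn_addr // ltq1.
  by rewrite ltn_add2l ltq2 // inE jJ.
- move=> t ltt; have [ltt1|let1] := ltnP t k1.
    have := ind1 t ltt1; congr indecomposable; apply/setP=> x; rewrite !inE.
      by case: (x \in I) => //=; rewrite [_ == _](_ : _ = false) ?andbF //; lia.
    have [xJ|xJ] := boolP (x \in J); first by rewrite (subsetP sJ).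
    by rewrite /= [_ == _](_ : _ = false) ?andbF //; lia.
  have ltt2 : t - k1 < k2 by lia.
  have := ind2 _ ltt2; congr indecomposable; apply/setP=> x; rewrite !inE.
    have [xI|xI] /= := boolP (x \in I); first by rewrite (subsetP sI) //=; lia.
    have [xR|//] := boolP (x \in R).
    have : p1 x < k1 by rewrite ltp1 // inE xI.
    by move=> ?; symmetry; apply/negbTE; lia.
  have [xJ|xJ] /= := boolP (x \in J).
    have := ltq1 x xJ => ?; rewrite [_ == _](_ : _ = false) ?andbF //; lia.
  by congr (_ && _); lia.
- move=> i j iR jC /=; have [iI|iI] := boolP (i \in I);
    have [jJ|jJ] := boolP (j \in J).
  + by move=> _; apply: (anticompleteP _ _ acIJ).
  + by rewrite ltn_add2l; apply: tri2; rewrite ?inE ?jJ.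
  + by apply: tri1; rewrite ?inE ?iI.
  (* The remaining quadrant lies above the diagonal, so the premise fails. *)
  + have : p1 i < k1 by rewrite ltp1 // inE iI.
    by lia.
Qed.

End BlockDecomposition.

(** * Block triangular matrices *)

Lemma subset_of_card (T : finType) (S : {set T}) k : (k <= #|S|)%N ->
  exists2 S' : {set T}, S' \subset S & #|S'| = k.
Proof.
case/card_geqP=> s [us <- sS]; exists [set x in s].
  by apply/subsetP => x; rewrite inE; apply: sS.
by rewrite cardsE (card_uniqP us).
Qed.

Definition nonzero m n (M : 'M[int]_(m, n)) i j := M i j != 0.

Lemma zero_submxP m n (M : 'M[int]_(m, n)) (I : {set 'I_m}) (J : {set 'I_n}) :
  reflect (forall i j, i \in I -> j \in J -> M i j = 0)
          (anticomplete (nonzero M) I J).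
Proof.
apply: (iffP (anticompleteP _ _ _)) => M0 i j iI jJ; first last.
  by rewrite /nonzero M0 ?eqxx.
by apply/eqP/negPn/M0.
Qed.

(** Any nonempty zero block with [#|I| + #|J| >= r] can be trimmed to the exact shape k x (r - k)
    when [r > 1]; for [r = 1] it is the whole matrix. *)
Lemma fully_indecomposableP r (M : 'M[int]_r) :
  fully_indecomposable M <->
  zero_one_mx M /\ indecomposable (nonzero M) setT setT.
Proof.
rewrite /indecomposable cardsT card_ord.
split=> [[r_gt0 M01 npd] | [M01 [_ r_gt0 indec]]]; split=> //.
  split=> // I J _ _ I0 J0 /zero_submxP M0; rewrite ltnNge; apply/negP => le.
  rewrite -card_gt0 in I0; rewrite -card_gt0 in J0.
  apply: npd; case: (ltnP 1 r) => [r_gt1|r_le1].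
    (* The cap [r - 1] keeps at least one column for [J']. *)
    have [I' sI' cI'] := subset_of_card (geq_minl #|I| (r - 1)).
    have leJ : (r - #|I'| <= #|J|)%N by rewrite cI'; lia.
    have [J' sJ' cJ'] := subset_of_card leJ.
    right; split=> //; exists #|I'|; split; first by rewrite cI'; lia.
    exists I', J'; split=> // i j iI' jJ'.
    by apply: M0; [apply: (subsetP sI') | apply: (subsetP sJ')].
  have r1 : r = 1%N by lia.
  have full (S : {set 'I_r}) : (0 < #|S|)%N -> S = setT.
    by move=> S0; apply/eqP; rewrite eqEcard subsetT cardsT card_ord; lia.
  by left; split=> // i j; apply: M0; rewrite (full I, full J).
have setT_neq0 : [set: 'I_r] != set0 by rewrite -card_gt0 cardsT card_ord.
case=> [[r1 M0]|[r_gt1 [k [/andP[k_gt0 ltkr] [I [J [cI cJ M0]]]]]]].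
  have : (#|[set: 'I_r]| + #|[set: 'I_r]| < r)%N.
    by apply: indec => //; apply/zero_submxP.
  by rewrite cardsT card_ord; lia.
have : (#|I| + #|J| < r)%N.
  apply: indec; rewrite ?subsetT -?card_gt0 ?cI ?cJ //; first by lia.
  exact/zero_submxP.
by rewrite cI cJ; lia.
Qed.

(** The right-hand side of the theorem, for an arbitrary matrix. *)
Definition block_triangular n (M : 'M[int]_n) : Prop :=
  exists (P Q : 'M[int]_n) (k : nat) (r : 'I_k -> nat)
         (sum_r : (\sum_(i < k) r i)%N = n)
         (Y : forall i j : 'I_k, 'M[int]_(r i, r j)),
    [/\ is_perm_mx P /\ is_perm_mx Q,
        (1 <= k)%N,
        P *m M *m Q
          = castmx (sum_r, sum_r) (\mxblock_(i < k, j < k) Y i j),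
        forall i : 'I_k, fully_indecomposable (Y i i) &
        (forall i j : 'I_k, (j < i)%N -> Y i j = 0) /\
        (forall i j : 'I_k, (i < j)%N -> zero_one_mx (Y i j))].

Lemma card_sum_ord k (r : 'I_k -> nat) (S : {set 'I_(\sum_i r i)}) :
  (#|S| = \sum_i #|[set u : 'I_(r i) | tagnat.Rank i u \in S]|)%N.
Proof.
rewrite -sum1_card (reindex _ (onW_bij _ tagnat.rank_bij)) /=.
under [RHS]eq_bigr => i _ do rewrite -sum1dep_card.
rewrite (sig_big_dep (fun=> true)
  (fun i (u : 'I_(r i)) => tagnat.Rank i u \in S) (fun _ _ => 1%N)) /=.
by apply: eq_bigl => x; rewrite tagnat.rankE.
Qed.

(* Only the diagonal blocks matter: the trace of a zero block on each of them
   is a zero block. *)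
Lemma mxblock_small_zero_blocks k (r : 'I_k -> nat)
    (Y : forall i j : 'I_k, 'M[int]_(r i, r j)) :
  (forall i, fully_indecomposable (Y i i)) ->
  small_zero_blocks (nonzero (\mxblock_(i < k, j < k) Y i j)) setT setT.
Proof.
move=> fi I J _ _ /zero_submxP Y0.
rewrite cardsT card_ord !card_sum_ord -big_split /=; apply: leq_sum => i _.
set Ii := [set u | _]; set Ji := [set u | _].
have [_ [_ r_gt0 indec]] := (fully_indecomposableP _).1 (fi i).
rewrite cardsT card_ord in indec.
(* Indecomposability speaks of nonempty traces only; if one trace is empty, the other has at most
   [r i] elements anyway. *)
have [->|I0] := eqVneq Ii set0.
  by rewrite cards0 -[leqRHS]card_ord max_card.
have [->|J0] := eqVneq Ji set0.
  by rewrite cards0 addn0 -[leqRHS]card_ord max_card.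
apply/ltnW/indec; rewrite ?subsetT //.
apply/zero_submxP => u v; rewrite !inE => uI vJ.
by rewrite -(mxblockK Y) mxE Y0.
Qed.

(** Row and column permutations carry zero blocks to zero blocks of the same size. *)
Lemma block_triangular_small_zero_blocks n (M : 'M[int]_n) :
  block_triangular M -> small_zero_blocks (nonzero M) setT setT.
Proof.
case=> P [Q [k [r [sum_r [Y]]]]] [[/is_perm_mxP[s ->] /is_perm_mxP[t ->]]].
move=> _ eqM fi _ I J _ _ /zero_submxP M0; move: eqM; subst n.
rewrite castmx_id -row_permE -[t]invgK -col_permE => eqM.
have := mxblock_small_zero_blocks fi; rewrite -eqM.
move/(_ (s @^-1: I) (t^-1%g @^-1: J)); rewrite !subsetT !card_preimset.
- apply=> //; apply/zero_submxP => u v; rewrite !inE !mxE; exact: M0.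
- exact: perm_inj.
- exact: perm_inj.
Qed.

(** Concatenates enumerations of disjoint blocks: [p] recovers the block, and injectivity of [f i]
    the position in it. *)
Lemma tagnat_inj k (r : 'I_k -> nat) (T : Type) (f : forall i, 'I_(r i) -> T)
    (p : T -> 'I_k) :
  (forall i, injective (f i)) -> (forall i u, p (f i u) = i) ->
  injective (fun s : 'I_(\sum_i r i) => f (tagnat.sig1 s) (tagnat.sig2 s)).
Proof.
move=> f_inj pf s s' eqf; apply: tagnat.sig_inj; move: eqf.
rewrite /tagnat.sig1 /tagnat.sig2; case: (tagnat.sig s) => i u.
case: (tagnat.sig s') => i' u' /= eqf.
have eqi : i = i' by rewrite -(pf i u) eqf pf.
by subst i'; rewrite (f_inj _ _ _ eqf).
Qed.

Lemma mxsub_indecomposable m n r (M : 'M[int]_(m, n)) (f : 'I_r -> 'I_m)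
    (g : 'I_r -> 'I_n) (R : {set 'I_m}) (C : {set 'I_n}) :
  injective f -> injective g ->
  (forall u, f u \in R) -> (forall v, g v \in C) ->
  #|R| = r -> indecomposable (nonzero M) R C ->
  indecomposable (nonzero (mxsub f g M)) setT setT.
Proof.
move=> f_inj g_inj fR gC cR [_ r_gt0 indec]; rewrite cR in r_gt0 indec.
rewrite /indecomposable !cardsT card_ord; split=> //.
move=> I J _ _ I0 J0 /zero_submxP M0.
rewrite -(card_imset _ f_inj) -(card_imset _ g_inj); apply: indec.
- by apply/subsetP=> _ /imsetP[u _ ->].
- by apply/subsetP=> _ /imsetP[u _ ->].
- by rewrite imset_eq0.
- by rewrite imset_eq0.
- apply/zero_submxP => _ _ /imsetP[u uI ->] /imsetP[v vJ ->].
  by have := M0 u v uI vJ; rewrite mxE.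
Qed.

Lemma small_zero_blocks_block_triangular n (M : 'M[int]_n) :
  (0 < n)%N -> zero_one_mx M -> small_zero_blocks (nonzero M) setT setT ->
  block_triangular M.
Proof.
move=> n_gt0 M01 hall.
have [||k [p0 [q0 [k_gt0 ltp ltq indec tri]]]] :=
  indecomposable_blocks _ _ hall; rewrite ?cardsT ?card_ord //.
pose p i : 'I_k := Ordinal (ltp i (in_setT i)).
pose q i : 'I_k := Ordinal (ltq i (in_setT i)).
pose R t := [set i | p i == t]; pose C t := [set j | q j == t].
have {}indec t : indecomposable (nonzero M) (R t) (C t).
  have := indec _ (ltn_ord t); congr indecomposable;
    by apply/setP=> i; rewrite !inE.
have cRC t : #|R t| = #|C t| by case: (indec t).
pose r t := #|R t|.
have sum_r : (\sum_(t < k) r t)%N = n.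
  rewrite -[RHS]card_ord -sum1_card (partition_big p (fun=> true)) //=.
  by apply: eq_bigr => t _; rewrite sum1dep_card.
pose f t (u : 'I_(r t)) : 'I_n := enum_val u.
(* Columns are indexed by [r t], the number of rows, so that the diagonal blocks are square by
   type. *)
pose g t (v : 'I_(r t)) : 'I_n := enum_val (cast_ord (cRC t) v).
have fR t u : f t u \in R t by apply: enum_valP.
have gC t v : g t v \in C t by apply: enum_valP.
have pf t u : p (f t u) = t by have := fR t u; rewrite inE => /eqP.
have qg t v : q (g t v) = t by have := gC t v; rewrite inE => /eqP.
have f_inj t : injective (f t) by apply: enum_val_inj.
have g_inj t : injective (g t).
  by move=> u v /enum_val_inj/cast_ord_inj.
have s_inj := inj_comp (tagnat_inj f_inj pf) (@cast_ord_inj _ _ (esym sum_r)).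
have t_inj := inj_comp (tagnat_inj g_inj qg) (@cast_ord_inj _ _ (esym sum_r)).
(* The inverse appears because [col_permE] turns a column permutation into right multiplication by
   the inverse permutation matrix. *)
exists (perm_mx (perm s_inj)), (perm_mx (perm t_inj)^-1), k, r, sum_r.
exists (fun i j => mxsub (f i) (g j) M).
have sub01 i j : zero_one_mx (mxsub (f i) (g j) M) by move=> u v; rewrite mxE.
split=> //; first by split; apply: perm_mx_is_perm.
- rewrite -row_permE -col_permE; apply/matrixP => u v.
  by rewrite castmxE !mxE !permE.
- move=> i; apply/fully_indecomposableP; split=> //.
  exact: (mxsub_indecomposable (f_inj i) (g_inj i) (fR i) (gC i)).
- split=> // i j ltji; apply/matrixP=> u v; rewrite !mxE.
  apply/eqP/negPn/(tri (f i u) (g j v)); rewrite ?in_setT //.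
  by rewrite -[p0 _]/(val (p _)) -[q0 _]/(val (q _)) pf qg.
Qed.

(** * Stable sets as zero blocks of the reduced adjacency matrix *)

Section Balanced.

Variables (T : finType) (G : sgraph T) (n : nat) (A B : {set T}).
Variables (a b : 'I_n -> T).
Hypotheses (bipG : bipartition G A B).
Hypotheses (enumA : enumerates a A) (enumB : enumerates b B).

Lemma reduced_adj_zero_one : zero_one_mx (reduced_adj G a b).
Proof. by move=> i j; rewrite mxE; case: ifP; [right | left]. Qed.

Lemma nonzero_reduced_adj i j : nonzero (reduced_adj G a b) i j = G (a i) (b j).
Proof. by rewrite /nonzero mxE; case: (G _ _). Qed.

Lemma imset_enumU_stable (I J : {set 'I_n}) :
  stable G (a @: I :|: b @: J) = anticomplete (nonzero (reduced_adj G a b)) I J.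
Proof.
have [_ _ /stableP stA /stableP stB] := bipG.
have [[_ imA] [_ imB]] := (enumA, enumB).
have aA i : a i \in A by rewrite -imA imset_f.
have bB j : b j \in B by rewrite -imB imset_f.
apply/stableP/anticompleteP => [st i j iI jJ | ac x y].
  by rewrite nonzero_reduced_adj st // inE imset_f ?orbT.
have ac' i j : i \in I -> j \in J -> ~~ G (a i) (b j).
  by move=> iI jJ; rewrite -nonzero_reduced_adj ac.
rewrite !inE => /orP[] /imsetP[i iI ->] /orP[] /imsetP[j jJ ->].
- exact: stA.
- exact: ac'.
- by rewrite adj_sym ac'.
- exact: stB.
Qed.

Lemma card_imset_enumU (I J : {set 'I_n}) :
  #|a @: I :|: b @: J| = (#|I| + #|J|)%N.
Proof.
have [[a_inj imA] [b_inj imB]] := (enumA, enumB); have [_ dAB _ _] := bipG.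
rewrite cardsU !card_imset // disjoint_setI0 ?cards0 ?subn0 //.
by apply: disjointW dAB; [rewrite -imA | rewrite -imB];
  apply/subsetP=> _ /imsetP[i _ ->]; apply: imset_f.
Qed.

Lemma imset_enumU_preimset (S : {set T}) :
  a @: (a @^-1: S) :|: b @: (b @^-1: S) = S.
Proof.
have [[_ imA] [_ imB]] := (enumA, enumB); have [AB _ _ _] := bipG.
apply/setP=> x; rewrite inE; apply/orP/idP.
  by case=> /imsetP[i iS ->]; rewrite inE in iS.
move=> xS; have := in_setT x; rewrite -AB -imA -imB inE.
by case/orP=> /imsetP[i _ xi]; [left | right];
  rewrite xi imset_f // inE -xi.
Qed.

(** Every vertex set is [a @: I :|: b @: J] with [#|I| + #|J|] elements, and it is stable exactly
    when [I] x [J] is a zero block, since edges only join [A] to [B]. *)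
Lemma alpha_le_small_zero_blocks :
  (alpha G <= n)%N <->
  small_zero_blocks (nonzero (reduced_adj G a b)) setT setT.
Proof.
rewrite /small_zero_blocks cardsT card_ord.
split=> [le I J _ _ | hall].
  rewrite -imset_enumU_stable -card_imset_enumU => st.
  exact: leq_trans (leq_alpha st) le.
have [S + <-] := alpha_witness G.
rewrite -[S]imset_enumU_preimset imset_enumU_stable card_imset_enumU.
by apply: hall; apply: subsetT.
Qed.

End Balanced.

Theorem theorem6 (T : finType) (G : sgraph T) (n : nat) (A B : {set T})
    (a b : 'I_n -> T)
    (n_ge1 : (1 <= n)%N)
    (cardT : #|T| = (2 * n)%N)
    (bipG : bipartition G A B)
    (balanced : #|A| = #|B|)
    (enumA : enumerates a A)
    (enumB : enumerates b B) :
  alpha_plus_stable G <->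
  exists (P Q : 'M[int]_n) (k : nat) (r : 'I_k -> nat)
         (sum_r : (\sum_(i < k) r i)%N = n)
         (Y : forall i j : 'I_k, 'M[int]_(r i, r j)),
    [/\ is_perm_mx P /\ is_perm_mx Q,
        (1 <= k)%N,
        P *m reduced_adj G a b *m Q
          = castmx (sum_r, sum_r) (\mxblock_(i < k, j < k) Y i j),
        forall i : 'I_k, fully_indecomposable (Y i i) &
        (forall i j : 'I_k, (j < i)%N -> Y i j = 0) /\
        (forall i j : 'I_k, (i < j)%N -> zero_one_mx (Y i j))].
Proof.
have cA : #|A| = n by case: enumA => a_inj <-; rewrite card_imset ?card_ord.
have alphaP := alpha_le_small_zero_blocks bipG enumA enumB.
have apsP := alpha_plus_stable_balanced bipG balanced; rewrite cA in apsP.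
split=> [/apsP.1/alphaP hall | bt].
  apply: small_zero_blocks_block_triangular => //.
  exact: reduced_adj_zero_one.
exact/apsP.2/alphaP/block_triangular_small_zero_blocks.
Qed.
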